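(* Let $N$ be a finite nonempty nilpotent semigroup with $|N|=n$. Then the subsemigroup complex ${\cal H}(N)$ is the uniform matroid $U_{n,n}$; that is, every subset of $N$ is a face of ${\cal H}(N)$.
   Context: A semigroup $N$ with zero $0$ is nilpotent if $N^k=\{0\}$ for some positive integer $k$. For a finite nonempty semigroup $S$ and $Y\subseteq S$, $Y^+$ denotes the subsemigroup generated by $Y$ ($\emptyset^+=\emptyset$). The subsemigroup complex ${\cal H}(S)$ has vertex set $S$, and $X\subseteq S$ is a face iff it admits an enumeration $x_1,\dots,x_k$ with $\emptyset\subset\{x_1\}^+\subset\{x_1,x_2\}^+\subset\cdots\subset\{x_1,\dots,x_k\}^+$ (all inclusions strict). *)

(* Defs.v *)
From HB Require Import structures.
From mathcomp Require Import all_boot.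

Set Implicit Arguments.
Unset Strict Implicit.
Unset Printing Implicit Defensive.

Local Open Scope group_scope.

#[short(type="finSemigroupType")]
HB.structure Definition FinSemigroup := {S of Semigroup S & Finite S}.

Section Semigroups.
Variable S : finSemigroupType.
Implicit Types (x z : S) (A B X Y : {set S}) (k : nat).

(* As the whole of S is always in the range, this intersection is never empty;
   the empty set counts as closed, so that the closure of set0 is set0. *)
Definition subsemigroup_gen Y : {set S} :=
  \bigcap_(A : {set S} | (Y \subset A) &&
     [forall x in A, forall y in A, x * y \in A]) A.

Definition is_zero z := forall x, z * x = z /\ x * z = z.

Definition set_prod A B : {set S} := [set x * y | x in A, y in B].

(* Used only for k > 0: the value setT at k = 0 is a dummy one. *)
Definition semigroup_pow k : {set S} :=
  iter k.-1 (fun A => set_prod A [set: S]) [set: S].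

Definition nilpotent_semigroup :=
  exists2 z, is_zero z & exists2 k, 0 < k & semigroup_pow k = [set z].

(* The step i = 0 reads set0 \proper {x_1}^+, because set0^+ = set0. *)
Definition strict_chain (s : seq S) :=
  [forall i : 'I_(size s),
     subsemigroup_gen [set x in take i s]
       \proper subsemigroup_gen [set x in take i.+1 s]].

Definition subsemigroup_face X :=
  [exists t : #|X|.-tuple S, ([set x in t] == X) && strict_chain t].

Definition subsemigroup_complex : {set {set S}} :=
  [set X | subsemigroup_face X].

End Semigroups.

Arguments nilpotent_semigroup : clear implicits.
Arguments subsemigroup_complex : clear implicits.

Record matroid (T : finType) := Matroid {
  indep : {set {set T}};
  indep_set0 : set0 \in indep;
  indep_sub : forall I J : {set T}, J \in indep -> I \subset J -> I \in indep;
  indep_aug : forall I J : {set T}, I \in indep -> J \in indep -> #|I| < #|J| ->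
    exists2 e, e \in J :\: I & e |: I \in indep
}.

Section Uniform.
Variables (T : finType) (r : nat).

Definition uniform_indep : {set {set T}} := [set X : {set T} | #|X| <= r].

Fact uniform_indep_set0 : set0 \in uniform_indep.
Proof. by rewrite inE cards0. Qed.

Fact uniform_indep_sub (I J : {set T}) :
  J \in uniform_indep -> I \subset J -> I \in uniform_indep.
Proof. by rewrite !inE => leJ /subset_leq_card/leq_trans; apply. Qed.

Fact uniform_indep_aug (I J : {set T}) :
    I \in uniform_indep -> J \in uniform_indep -> #|I| < #|J| ->
  exists2 e, e \in J :\: I & e |: I \in uniform_indep.
Proof.
rewrite !inE => _ leJ ltIJ.
have /set0Pn[e eJI] : J :\: I != set0.
  by rewrite setD_eq0; apply: contraL ltIJ => /subset_leq_card; rewrite -leqNgt.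
exists e => //; move: eJI; rewrite !inE => /andP[eI _].
by rewrite cardsU1 eI; apply: leq_trans leJ.
Qed.

(* U_{r,n}, where n = #|T|. *)
Definition uniform_matroid : matroid T :=
  Matroid uniform_indep_set0 uniform_indep_sub uniform_indep_aug.

End Uniform.

(* Main.v *)
(** Let X be nonempty and not reduced to the zero, and let k be maximal with
    X contained in N^k. Any x in X outside N^(k+1) avoids the subsemigroup
    generated by the other elements of X, because (X \ {x}) together with
    N^(k+1) is closed under products. Removing such elements one at a time
    yields the required enumeration of X in reverse order; for X = {0} there is
    nothing to check, since the empty set generates the empty set. *)

Require Import Defs.
From mathcomp Require Import all_boot.

Set Implicit Arguments.
Unset Strict Implicit.
Unset Printing Implicit Defensive.

Section Generation.
Local Open Scope group_scope.
Variable S : finSemigroupType.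
Implicit Types (x : S) (A X Y : {set S}).

Lemma sub_subsemigroup_gen Y : Y \subset subsemigroup_gen Y.
Proof. by apply/bigcapsP => A /andP[]. Qed.

Lemma subsemigroup_gen_min Y A :
  Y \subset A -> {in A &, forall x y, x * y \in A} -> subsemigroup_gen Y \subset A.
Proof.
move=> sYA clA; apply: bigcap_inf; rewrite sYA /=.
by apply/forall_inP => x xA; apply/forall_inP => y yA; apply: clA.
Qed.

Lemma subsemigroup_genS Y X :
  Y \subset X -> subsemigroup_gen Y \subset subsemigroup_gen X.
Proof.
move=> sYX; apply/bigcapsP => A /andP[sXA clA].
by apply: bigcap_inf; rewrite clA (subset_trans sYX).
Qed.

Lemma subsemigroup_gen0 : subsemigroup_gen set0 = set0 :> {set S}.
Proof.
by apply/eqP; rewrite -subset0 subsemigroup_gen_min // => x y; rewrite inE.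
Qed.

Lemma semigroup_powS k : semigroup_pow S k.+1 \subset semigroup_pow S k.
Proof.
(* Exponents 0 and 1 both give [setT], hence two base cases before the recursion starts. *)
elim: k => [|[|k] IHk]; [exact: subsetT | exact: subsetT |].
exact: imset2S.
Qed.

(** Prefixes no longer than [s] are unchanged, so only the last inclusion is new, and [x] itself
    witnesses its strictness. *)
Lemma strict_chain_rcons (s : seq S) x :
  strict_chain s -> x \notin subsemigroup_gen [set y in s] ->
  strict_chain (rcons s x).
Proof.
move=> /forallP cs xs; apply/forallP => -[i /=]; rewrite size_rcons ltnS => lei.
rewrite -cats1 leq_eqVlt in lei *; case/orP: lei => [/eqP-> | lti]; last first.
  by rewrite !takel_cat ?(ltnW lti) //; apply: cs (Ordinal lti).
rewrite takel_cat // take_size take_oversize ?size_cat ?addn1 //.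
apply/properP; split; last exists x => //.
  by apply/subsemigroup_genS/subsetP => y; rewrite !inE mem_cat => ->.
by apply: (subsetP (sub_subsemigroup_gen _)); rewrite !inE mem_cat mem_head orbT.
Qed.

Hypothesis S_nil : nilpotent_semigroup S.

Lemma nilpotent_independent_elt X :
  X != set0 -> exists2 x, x \in X & x \notin subsemigroup_gen (X :\ x).
Proof.
have [z _ [K _ powK]] := S_nil => X0.
(* Singletons are set apart because the one made of the zero lies in every power. *)
have [/existsP[x /eqP->] | X1] := boolP [exists x, X == [set x]].
  by exists x; rewrite ?set11 // setDv subsemigroup_gen0 inE.
have: exists k, ~~ (X \subset semigroup_pow S k).
  exists K; rewrite powK subset1 negb_or X0 andbT.
  by apply: contra X1 => /eqP->; apply/existsP; exists z.
(* The least failing exponent is at least 2, so its predecessor [k.+1] is a genuine power. *)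
case/ex_minnP => -[|[|k]]; rewrite ?subsetT // => /subsetPn[x xX xk] mink.
have sXk : X \subset semigroup_pow S k.+1.
  by apply: contraT => /mink; rewrite ltnn.
exists x => //; apply: contra xk => xgen.
have: x \in X :\ x :|: semigroup_pow S k.+2.
  apply: subsetP xgen; apply: subsemigroup_gen_min; first exact: subsetUl.
  (* Either way [a] lies in [semigroup_pow S k.+1], so [a * b] falls into the next power whatever
     [b] is. *)
  move=> a b aA _; apply/setUP; right; apply: imset2_f; last exact: in_setT.
  case/setUP: aA => [/setD1P[_] | ]; first exact: (subsetP sXk).
  exact: (subsetP (semigroup_powS _)).
by rewrite !inE eqxx.
Qed.

(** [uniq s] is carried along because a face asks for a tuple of length exactly [#|X|]. *)
Lemma nilpotent_strict_chain X :
  exists s, [/\ uniq s, [set y in s] = X & strict_chain s].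
Proof.
elim: {X}_.+1 {-2}X (ltnSn #|X|) => // n IHn X leXn.
have [-> | X0] := eqVneq X set0.
  by exists [::]; split=> //; apply/forallP; case.
have [x xX xgen] := nilpotent_independent_elt X0.
have [|s [us sX cs]] := IHn (X :\ x); first by rewrite (cardsD1 x X) xX in leXn.
have xs : x \notin s by move/setP/(_ x): sX; rewrite !inE eqxx => ->.
exists (rcons s x); split; first by rewrite rcons_uniq xs.
  by rewrite -(setD1K xX) -sX; apply/setP => y; rewrite !inE mem_rcons inE.
by apply: strict_chain_rcons; rewrite ?sX.
Qed.

Lemma nilpotent_face X : X \in subsemigroup_complex S.
Proof.
have [s [us sX cs]] := nilpotent_strict_chain X.
have sz : size s == #|X| by rewrite -sX cardsE (card_uniqP us).
by rewrite inE; apply/existsP; exists (Tuple sz); rewrite cs andbT; apply/eqP.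
Qed.

End Generation.

Theorem theorem5p7 (N : finSemigroupType) (n : nat) (N_gt0 : (0 < #|N|)%N)
    (N_nil : nilpotent_semigroup N) (cardN : #|N| = n) :
  subsemigroup_complex N = indep (uniform_matroid N n) /\
  forall X : {set N}, X \in subsemigroup_complex N.
Proof.
split; last exact: nilpotent_face.
(* For rank [#|N|] the cardinality bound holds for every subset. *)
by apply/setP => X; rewrite nilpotent_face // inE -cardN max_card.
Qed.
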